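(* Let $\alpha_t\in(0,1)$ with $\gamma_1/\gamma_2>\alpha_t$ and let $u_t\in\{0,1\}^{N_{\mathrm{HVAC}}}$. The distributionally robust chance constraint $$\inf_{f\in\mathcal D_t^1}\mathbb P_f\Big(\sum_{\ell=1}^{N_{\mathrm{HVAC}}}P_\ell u_{t,\ell}-\sum_{i=1}^{N_{\mathrm{PV}}}\widetilde P_{\mathrm{PV},t,i}\ge0\Big)\ge1-\alpha_t,$$ or equivalently $$\sum_{\ell=1}^{N_{\mathrm{HVAC}}}P_\ell u_{t,\ell}\ge\theta_t+\sqrt{\frac{\gamma_2}{\alpha_t}}\,\sigma_t,$$ holds if and only if there exist $\phi,q,w\in\mathbb R$ such that $$\sum_{\ell=1}^{N_{\mathrm{HVAC}}}P_\ell u_{t,\ell}\ge\theta_t+\phi\,\sigma_t\sqrt{\gamma_2},\qquad \alpha_t+\phi\ge\left\|\begin{pmatrix}\alpha_t-\phi\\2q\end{pmatrix}\right\|_2,\qquad \phi\ge w^2,\qquad q+w\ge\left\|\begin{pmatrix}q-w\\2\end{pmatrix}\right\|_2.$$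
   Context: $N_{\mathrm{HVAC}},N_{\mathrm{PV}}\ge1$ are integers, $P_\ell>0$ is the energy consumption of unit $\ell$, and $t$ is a fixed period. $\widetilde P_{\mathrm{PV},t}$ is a random vector in $\mathbb R^{N_{\mathrm{PV}}}$ with distribution $f$; $\mathbb P_f,\mathbb E_f$ denote probability and expectation under $f$. Given $\mu_t\in\mathbb R^{N_{\mathrm{PV}}}$, a positive definite matrix $\Sigma_t$ (the empirical mean and covariance of samples), and $\gamma_1\ge0$, $\gamma_2\ge\max\{\gamma_1,1\}$, the moment-based ambiguity set $\mathcal D_t^1$ is the set of all distributions $f$ with $\mathbb P_f(\widetilde P_{\mathrm{PV},t}\in\mathbb R^{N_{\mathrm{PV}}})=1$, $(\mathbb E_f[\widetilde P_{\mathrm{PV},t}]-\mu_t)^\top\Sigma_t^{-1}(\mathbb E_f[\widetilde P_{\mathrm{PV},t}]-\mu_t)\le\gamma_1$, and $\mathbb E_f[(\widetilde P_{\mathrm{PV},t}-\mu_t)(\widetilde P_{\mathrm{PV},t}-\mu_t)^\top]\preceq\gamma_2\Sigma_t$. Put $\theta_t=\mathbf 1^\top\mu_t$ and $\sigma_t=\sqrt{\mathbf 1^\top\Sigma_t\mathbf 1}$, where $\mathbf 1$ is the all-ones vector. *)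

(* Defs.v *)
From HB Require Import structures.
From mathcomp Require Import all_boot all_order all_algebra.
From mathcomp Require Import all_classical all_reals all_analysis.
Import Order.TTheory GRing.Theory Num.Theory.
Import numFieldNormedType.Exports.

Set Implicit Arguments.
Unset Strict Implicit.
Unset Printing Implicit Defensive.

Local Open Scope classical_set_scope.
Local Open Scope ring_scope.

Definition quadform (R : realType) n (A : 'M[R]_n) (x : 'cV[R]_n) : R :=
  (x^T *m A *m x) 0 0.

Definition posdefmx (R : realType) n (A : 'M[R]_n) : Prop :=
  A^T = A /\ forall x : 'cV[R]_n, x != 0 -> 0 < quadform A x.

Definition possemidefmx (R : realType) n (A : 'M[R]_n) : Prop :=
  A^T = A /\ forall x : 'cV[R]_n, 0 <= quadform A x.

(* The Loewner order. *)
Definition lemx (R : realType) n (A B : 'M[R]_n) : Prop :=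
  possemidefmx (B - A).

(* The library norm on matrices is the sup norm, hence this definition. *)
Definition l2norm (R : realType) n (x : 'cV[R]_n) : R :=
  Num.sqrt (\sum_(i < n) x i 0 ^+ 2).

Definition col2 (R : realType) (a b : R) : 'cV[R]_2 :=
  \col_(i < 2) [:: a; b]`_i.

(* A distribution on R^n is a probability measure on [n.-tuple R], whose
   canonical sigma-algebra is the product of the Borel ones.  The random vector
   is the identity on that space. *)
Definition mean_vec (R : realType) n (f : probability (n.-tuple R) R) :
    'cV[R]_n :=
  \col_i fine ('E_f[(fun xi => tnth xi i)%R])%E.

Definition second_moment_about (R : realType) n
    (f : probability (n.-tuple R) R) (mu : 'cV[R]_n) : 'M[R]_n :=
  \matrix_(i, j)
    fine ('E_f[(fun xi => (tnth xi i - mu i 0) * (tnth xi j - mu j 0))%R])%E.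

(* The integrability clauses say that the expectations in the two moment
   constraints exist and are finite; [fine] would otherwise return 0. *)
Definition moment_ambiguity_set (R : realType) n (mu : 'cV[R]_n)
    (Sigma : 'M[R]_n) (gamma1 gamma2 : R) : set (probability (n.-tuple R) R) :=
  [set f : probability (n.-tuple R) R | [/\ f [set: n.-tuple R] = 1%E,
      forall i : 'I_n, f.-integrable setT (fun xi => (tnth xi i)%:E),
      forall i j : 'I_n, f.-integrable setT
        (fun xi => ((tnth xi i - mu i 0) * (tnth xi j - mu j 0))%:E),
      quadform (invmx Sigma) (mean_vec f - mu) <= gamma1
    & lemx (second_moment_about f mu) (gamma2 *: Sigma)]].

(* Main.v *)
Require Import Defs.
From HB Require Import structures.
From mathcomp Require Import all_boot all_order all_algebra.
From mathcomp Require Import all_classical all_reals all_analysis.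
From mathcomp Require Import unstable measurable_realfun ring lra.
Import Order.TTheory GRing.Theory Num.Theory.
Import numFieldNormedType.Exports.

Local Open Scope classical_set_scope.
Local Open Scope ring_scope.

(** Write [q] for the quadratic form of [Sigma], [v] for the all-ones vector,
    and [t = sqrt (gamma2 / alpha * q v)].  The distributionally robust
    constraint asks that, for every admissible law, the linear functional
    [v^T xi] exceed [load] with probability at most [alpha].

    If [v^T mu + t <= load], this is the second-moment form of Chebyshev's
    inequality: the Loewner bound on the second moment about [mu] gives
    [E (v^T xi - v^T mu)^2 <= gamma2 * q v], so the mass beyond [v^T mu + t] is
    at most [gamma2 * q v / t^2 = alpha] ([dotp_tail_le]).

    If [load < v^T mu + t], some admissible law violates the constraint: for
    [p] slightly larger than [alpha], put mass [p] at [mu + s * Sigma v] and mass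
    [1 - p] at [mu], with [s^2 = gamma2 / (p * q v)].  Its second moment about
    [mu] is the rank-one matrix [p * s^2 * (Sigma v) (Sigma v)^T], which is below
    [gamma2 * Sigma] by the Cauchy-Schwarz inequality for [q]; the squared
    [Sigma^-1]-norm of its mean displacement is
    [(p * s)^2 * q v = p * gamma2], which is at most [gamma1] exactly when
    [p <= gamma1 / gamma2].  The hypothesis [alpha < gamma1 / gamma2] leaves room
    for such a [p > alpha], and for [p] close to [alpha] the far atom still lies
    beyond [load] ([two_point_ambiguity], [drcc_halfspaceP]).

    Finally, each norm inequality of the conic system is a rotated second-order
    cone: the system says [q^2 <= alpha * phi], [w^2 <= phi], [1 <= q * w] with
    nonnegative sums.  Multiplying, [1 <= alpha * phi^2], that is
    [1 / sqrt alpha <= phi], and conversely every such [phi] is reached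
    ([cone_chainP]).  Taking the least [phi] turns the linear inequality of the
    system into [v^T mu + t <= load]. *)

(** * The conic system *)

(** Squaring, the difference of the two sides is
    [(a + b)^2 - (a - b)^2 - (2 c)^2 = 4 (a b - c^2)]. *)
Lemma rotated_cone_ineq {R : realType} (a b c : R) :
  (l2norm (col2 (a - b) (2 * c)) <= a + b) = (0 <= a + b) && (c ^+ 2 <= a * b).
Proof.
rewrite /l2norm !big_ord_recl big_ord0 !mxE /= addr0.
have [ab|ab] /= := leP 0 (a + b); last first.
  by apply/negbTE; rewrite -ltNge; apply: lt_le_trans ab (sqrtr_ge0 _).
rewrite -[leRHS]ger0_norm // -sqrtr_sqr ler_sqrt ?sqr_ge0 //.
by apply/idP/idP => h; nra.
Qed.

(** The auxiliary variables [q] and [w] eliminate [1 / sqrt a <= x] into conic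
    constraints: [1 <= (q w)^2 <= (a x) x]. *)
Lemma cone_chainP {R : realType} (a x : R) : 0 < a ->
  (exists q w : R, [/\ l2norm (col2 (a - x) (2 * q)) <= a + x,
     w ^+ 2 <= x & l2norm (col2 (q - w) 2) <= q + w]) <->
  (Num.sqrt a)^-1 <= x.
Proof.
move=> a0; have s0 : 0 < Num.sqrt a by rewrite sqrtr_gt0.
have sa : Num.sqrt a ^+ 2 = a by rewrite sqr_sqrtr ?ltW.
split=> [[q [w []]]|hx].
  rewrite -[X in col2 (q - w) X]mulr1 !rotated_cone_ineq expr1n.
  move=> /andP[_ qx] wx /andP[_ qw].
  have x0 : 0 <= x by apply: le_trans wx; exact: sqr_ge0.
  have qw2 : 1 <= q ^+ 2 * w ^+ 2 by rewrite -exprMn; apply: exprn_ege1.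
  rewrite -[_^-1]mulr1 ler_pdivrMl // -(@ler_pXn2r _ 2) ?nnegrE //; last first.
    by rewrite mulr_ge0 // ltW.
  rewrite expr1n exprMn sa; apply: (le_trans qw2).
  apply: (le_trans (ler_pM (sqr_ge0 q) (sqr_ge0 w) qx wx)).
  by rewrite expr2 mulrA.
set r := Num.sqrt a in s0 sa hx.
have t0 : 0 < Num.sqrt r by rewrite sqrtr_gt0.
have tr : Num.sqrt r ^+ 2 = r by rewrite sqr_sqrtr ?ltW.
have x0 : 0 < x by apply: lt_le_trans hx; rewrite invr_gt0.
have rx : 1 <= r * x by rewrite -ler_pdivrMl // mulr1.
(* At the least [x] all three constraints are tight, which forces
   [q = 1 / w = a^(1/4)]. *)
exists (Num.sqrt r), (Num.sqrt r)^-1; split.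
- rewrite rotated_cone_ineq tr (addr_ge0 (ltW a0) (ltW x0)) -sa expr2 -mulrA.
  by rewrite ler_peMr // ltW.
- by rewrite exprVn tr.
- rewrite -[X in col2 (_ - _) X]mulr1 rotated_cone_ineq expr1n.
  by rewrite divff ?gt_eqF // lexx andbT addr_ge0 ?invr_ge0 // ltW.
Qed.

(** * Positive definite quadratic forms *)

Lemma quadformE {R : realType} {n} (A : 'M[R]_n) (x : 'cV[R]_n) :
  quadform A x = \sum_i \sum_j x i 0 * x j 0 * A i j.
Proof.
rewrite /quadform mxE exchange_big /=; apply: eq_bigr => j _.
by rewrite mxE mulr_suml; apply: eq_bigr => i _; rewrite mxE; ring.
Qed.

Lemma quadformB {R : realType} {n} (A B : 'M[R]_n) x :
  quadform (A - B) x = quadform A x - quadform B x.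
Proof. by rewrite /quadform mulmxBr mulmxBl !mxE. Qed.

Lemma quadformZ {R : realType} {n} c (A : 'M[R]_n) x :
  quadform (c *: A) x = c * quadform A x.
Proof. by rewrite /quadform -scalemxAr -scalemxAl !mxE. Qed.

Lemma posdefmx_ge0 {R : realType} {n} (A : 'M[R]_n) x :
  posdefmx A -> 0 <= quadform A x.
Proof.
move=> [_ pA]; have [->|/pA/ltW//] := eqVneq x 0.
by rewrite /quadform mulmx0 mxE.
Qed.

Lemma posdefmx_unit {R : realType} {n} (A : 'M[R]_n) :
  posdefmx A -> A \in unitmx.
Proof.
move=> [_ pA]; rewrite -row_free_unit -kermx_eq0; apply/negPn/negP.
move=> /rowV0Pn[v /sub_kermxP vA v0].
have /pA : v^T != 0 by rewrite -(inj_eq trmx_inj) trmxK trmx0.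
by rewrite /quadform trmxK vA mul0mx mxE ltxx.
Qed.

(** With [b] the bilinear value and [c = quadform A y > 0], the form is
    nonnegative at [c x - b y], where it equals
    [c (quadform A x * c - b^2)]. *)
Lemma posdefmx_cauchy_schwarz {R : realType} {n} (A : 'M[R]_n)
    (x y : 'cV[R]_n) :
  posdefmx A ->
  ((x^T *m A *m y) 0 0) ^+ 2 <= quadform A x * quadform A y.
Proof.
move=> pA; have [->|y0] := eqVneq y 0.
  by rewrite /quadform !mulmx0 mxE expr0n mulr0.
have qy : 0 < quadform A y by case: pA => _; apply.
set b := (x^T *m A *m y) 0 0; set c := quadform A y in qy *.
have bC : (y^T *m A *m x) 0 0 = b.
  rewrite /b -[in LHS](trmxK x) -[A in LHS]pA.1 -mulmxA.
  by rewrite -trmx_mul -trmx_mul mxE.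
have := posdefmx_ge0 _ (c *: x - b *: y) pA.
rewrite {1}/quadform.
have -> : (c *: x - b *: y)^T = c *: x^T - b *: y^T.
  by apply/matrixP=> i j; rewrite !mxE.
rewrite !mulmxBl !mulmxBr -!scalemxAl -!scalemxAr.
have entryZZ (M : 'M[R]_1) k l : (k *: (l *: M)) 0 0 = k * (l * M 0 0).
  by rewrite !mxE.
have entryB (M N P Q : 'M[R]_1) : (M - N - (P - Q)) 0 0 =
  M 0 0 - N 0 0 - (P 0 0 - Q 0 0) by rewrite !mxE.
rewrite entryB !entryZZ bC -/b -/(quadform A x) -/(quadform A y) -/c.
rewrite (_ : _ - _ = c * (quadform A x * c - b ^+ 2)); last by ring.
by rewrite pmulr_rge0 // subr_ge0.
Qed.

(** * The tail of a linear functional under a second-moment bound *)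

Definition dotp {R : realType} {n} (v : 'cV[R]_n) (xi : n.-tuple R) : R :=
  \sum_(i < n) v i 0 * tnth xi i.

Lemma measurable_dotp {R : realType} {n} (v : 'cV[R]_n) :
  measurable_fun [set: n.-tuple R] (dotp v).
Proof.
apply: measurable_sum => i; apply: measurable_funM => //.
exact: measurable_tnth.
Qed.

Lemma measurable_dotp_le {R : realType} {n} (v : 'cV[R]_n) (b : R) :
  measurable [set xi | (dotp v xi <= b)%R].
Proof.
rewrite -[X in measurable X]setTI.
exact: (measurable_fun_le measurableT (measurable_dotp v) (measurable_cst b)).
Qed.

Lemma measurable_le_dotp {R : realType} {n} (v : 'cV[R]_n) (b : R) :
  measurable [set xi | (b <= dotp v xi)%R].
Proof.
rewrite -[X in measurable X]setTI.
exact: (measurable_fun_le measurableT (measurable_cst b) (measurable_dotp v)).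
Qed.

Lemma dotpB {R : realType} {n} (v mu : 'cV[R]_n) xi :
  dotp v xi - (v^T *m mu) 0 0 = \sum_(i < n) v i 0 * (tnth xi i - mu i 0).
Proof.
by rewrite /dotp mxE -sumrB; apply: eq_bigr => i _; rewrite mxE; ring.
Qed.

Lemma integral_dotp_sqr {R : realType} {n} (f : probability (n.-tuple R) R)
    (v mu : 'cV[R]_n) :
  (forall i j : 'I_n, f.-integrable setT
     (fun xi => ((tnth xi i - mu i 0) * (tnth xi j - mu j 0))%:E)) ->
  (\int[f]_xi ((dotp v xi - (v^T *m mu) 0 0) ^+ 2)%:E)%E =
  (quadform (second_moment_about f mu) v)%:E.
Proof.
move=> intf.
have intv i j : f.-integrable setT (fun xi => ((v i 0 * v j 0)%:E *
    ((tnth xi i - mu i 0) * (tnth xi j - mu j 0))%:E)%E).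
  exact: integrableZl.
under eq_integral => xi _.
  have -> : ((dotp v xi - (v^T *m mu) 0 0) ^+ 2)%:E =
    (\sum_(i < n) \sum_(j < n) (v i 0 * v j 0)%:E *
      ((tnth xi i - mu i 0) * (tnth xi j - mu j 0))%:E)%E.
    rewrite dotpB expr2 mulr_suml -sumEFin; apply: eq_bigr => i _.
    rewrite mulr_sumr -sumEFin; apply: eq_bigr => j _.
    by rewrite -EFinM mulrACA.
  over.
rewrite integral_sum //; last by move=> i; exact: integrable_sum.
rewrite quadformE -sumEFin; apply: eq_bigr => i _.
rewrite integral_sum // -sumEFin; apply: eq_bigr => j _.
rewrite integralZl // mxE expectation.unlock [in RHS]EFinM fineK //.
exact: integrable_fin_num.
Qed.

(** Markov's inequality for the square.  The deviation is taken from [mu], which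
    need not be the mean, so that the second moment about [mu] replaces the
    covariance. *)
Lemma dotp_tail_le {R : realType} {n} (f : probability (n.-tuple R) R)
    (v mu : 'cV[R]_n) (t : R) : 0 < t ->
  (forall i j : 'I_n, f.-integrable setT
     (fun xi => ((tnth xi i - mu i 0) * (tnth xi j - mu j 0))%:E)) ->
  (f [set xi | (v^T *m mu) 0 0 + t <= dotp v xi]%R <=
   (quadform (second_moment_about f mu) v / t ^+ 2)%:E)%E.
Proof.
move=> t0 intf; have t20 : 0 < t ^+ 2 by rewrite exprn_gt0.
rewrite EFinM muleC -lee_pdivrMl ?invr_gt0 // invrK.
set g := fun xi => ((dotp v xi - (v^T *m mu) 0 0) ^+ 2)%:E.
have mg : measurable_fun setT g.
  apply/measurable_EFinP; apply: measurable_funX; apply: measurable_funB => //.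
  exact: measurable_dotp.
rewrite -integral_dotp_sqr //.
have -> : (\int[f]_xi g xi = \int[f]_xi `|g xi|)%E.
  by apply: eq_integral => xi _; rewrite gee0_abs // lee_fin sqr_ge0.
apply: le_trans (le_integral_abse f measurableT mg t20).
rewrite setTI; apply: lee_wpmul2l; first by rewrite lee_fin sqr_ge0.
have mA : measurable [set xi | ((t ^+ 2)%:E <= `|g xi|)%E].
  rewrite -[X in measurable X]setTI; apply: emeasurable_fun_c_infty => //.
  exact: measurableT_comp.
apply: le_measure; rewrite ?inE //; first exact: measurable_le_dotp.
move=> xi /= h; rewrite lee_fin ger0_norm ?sqr_ge0 //.
by apply: lerXn2r; rewrite ?nnegrE; lra.
Qed.

(** * Two-point laws *)

Definition two_points {T : Type} (a b : T) (c : bool) : T := if c then a else b.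

(** The law is the image of a Bernoulli measure, so that every integral reduces
    to one over [bool]. *)
Lemma two_point_law {d} {T : measurableType d} {R : realType} (p : R) (a b : T) :
  0 <= p <= 1 -> exists f : probability T R,
    (forall A, measurable A -> f A = p%:E * \d_a A + (1 - p)%:E * \d_b A)%E /\
    (forall g : T -> R, measurable_fun setT g ->
      f.-integrable setT (EFin \o g) /\
      (\int[f]_x (g x)%:E)%E = (p * g a + (1 - p) * g b)%:E).
Proof.
move=> p01.
have mX : measurable_fun setT (two_points a b) by [].
pose X := MeasurableFun.Pack
  (MeasurableFun.Class (isMeasurableFun.Build _ _ _ _ _ mX)).
exists (distribution (bernoulli_prob p) X); split.
  move=> A _; have := bernoulli_probE p01 (X @^-1` A).
  by rewrite /distribution /pushforward /= => ->; rewrite !diracE.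
move=> g mg; have mEg : measurable_fun setT (EFin \o g) by exact/measurable_EFinP.
have ib (h : bool -> R) : (bernoulli_prob p).-integrable setT (EFin \o h).
  apply/integrableP; split => //.
  by rewrite integral_bernoulli_prob //= -!EFinM -EFinD ltry.
split.
  by apply: integrable_pushforward => //; exact: ib (g \o X).
have /= -> := integral_distribution mEg (ib (g \o X)).
(* The Bernoulli integral formula holds for nonnegative integrands, whence the
   split into positive and negative parts. *)
rewrite integralE !integral_bernoulli_prob // !funeposE !funenegE /=.
rewrite -!EFin_max -!EFinM -!EFinD.
congr EFin; rewrite /onem.
have max0E (x : R) : Num.max x 0 = x + Num.max (- x) 0.
  by rewrite /Num.max; case: (ltrP x 0); case: (ltrP (- x) 0); lra.
by rewrite (max0E (g a)) (max0E (g b)); ring.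
Qed.

(** Displacing the far atom along [Sigma v] is optimal: among displacements [z]
    with [z z^T <= c Sigma] it maximizes [v^T z]. *)
Lemma two_point_ambiguity {R : realType} {n} (mu v : 'cV[R]_n)
    (Sigma : 'M[R]_n) (gamma1 gamma2 p s b : R) :
  posdefmx Sigma -> 0 <= p <= 1 ->
  p * s ^+ 2 * quadform Sigma v = gamma2 -> p * gamma2 <= gamma1 ->
  b < (v^T *m mu) 0 0 + s * quadform Sigma v ->
  exists2 f, moment_ambiguity_set mu Sigma gamma1 gamma2 f &
    (f [set xi | (dotp v xi <= b)%R] <= (1 - p)%:E)%E.
Proof.
move=> pS p01 psq pg hb; have uS := posdefmx_unit _ pS.
have [w wE] : exists w, w = Sigma *m v by exists (Sigma *m v).
pose hi := [tuple mu i 0 + s * w i 0 | i < n].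
pose lo := [tuple mu i 0 | i < n].
have [f [fA fE]] := two_point_law p hi lo p01.
have mX i : measurable_fun [set: n.-tuple R] (fun xi => tnth xi i).
  exact: measurable_tnth.
have mXX i j : measurable_fun [set: n.-tuple R]
    (fun xi => (tnth xi i - mu i 0) * (tnth xi j - mu j 0)).
  by apply: measurable_funM; apply: measurable_funB.
have meanE : mean_vec f - mu = (p * s) *: w.
  apply/colP => i; rewrite !mxE expectation.unlock (fE _ (mX i)).2 /=.
  by rewrite !tnth_mktuple; ring.
have momE : second_moment_about f mu = (p * s ^+ 2) *: (w *m w^T).
  apply/matrixP => i j; rewrite !mxE expectation.unlock (fE _ (mXX i j)).2 /=.
  by rewrite !tnth_mktuple big_ord1 !mxE; ring.
exists f.
  split.
  - exact: probability_setT.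
  - by move=> i; exact: (fE _ (mX i)).1.
  - by move=> i j; exact: (fE _ (mXX i j)).1.
  - suff -> : quadform (invmx Sigma) (mean_vec f - mu) = p * gamma2 by [].
    have wT : w^T = v^T *m Sigma by rewrite wE trmx_mul pS.1.
    rewrite meanE -psq /quadform [(_ *: w)^T]linearZ /= wT wE.
    rewrite -!scalemxAl -!scalemxAr mulmxK // mulmxA -/(quadform Sigma v) mxE mxE.
    by rewrite -/(quadform Sigma v); ring.
  - split.
      have wwT : (w *m w^T)^T = w *m w^T by rewrite trmx_mul trmxK.
      by rewrite momE linearB /= !linearZ /= pS.1 wwT.
    move=> x; rewrite quadformB quadformZ momE quadformZ subr_ge0 -psq.
    have -> : quadform (w *m w^T) x = ((x^T *m Sigma *m v) 0 0) ^+ 2.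
      have wx : (w^T *m x) 0 0 = (x^T *m w) 0 0.
        by rewrite -[w^T *m x]trmxK mxE trmx_mul trmxK.
      rewrite /quadform mulmxA -(mulmxA _ w^T) mxE big_ord1 wx -expr2.
      by rewrite wE mulmxA.
    rewrite -[leRHS]mulrA; apply: ler_wpM2l.
      by rewrite mulr_ge0 ?sqr_ge0 //; case/andP: p01.
    by rewrite mulrC; exact: posdefmx_cauchy_schwarz.
rewrite fA; last exact: measurable_dotp_le.
have -> : \d_hi [set xi | (dotp v xi <= b)%R] = 0%E :> \bar R.
  have hiE : dotp v hi = (v^T *m mu) 0 0 + s * quadform Sigma v.
    apply/eqP; rewrite addrC -subr_eq dotpB /quadform -mulmxA mxE mulr_sumr.
    apply/eqP; apply: eq_bigr => i _.
    by rewrite tnth_mktuple wE !mxE; ring.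
  by rewrite diracE memNset //=; apply/negP; rewrite -ltNge hiE.
rewrite mule0 add0e -[leRHS]mule1; apply: lee_wpmul2l.
  by rewrite lee_fin subr_ge0; case/andP: p01.
by rewrite diracE lee_fin; case: (_ \in _).
Qed.

(** * The robust constraint for a half-space *)

Lemma drcc_halfspaceP {R : realType} {n} (mu v : 'cV[R]_n) (Sigma : 'M[R]_n)
    (gamma1 gamma2 alpha b : R) :
  posdefmx Sigma -> v != 0 -> 0 < alpha -> 0 < gamma2 -> gamma1 <= gamma2 ->
  alpha < gamma1 / gamma2 ->
  ((1 - alpha)%:E <= ereal_inf [set f [set xi | (dotp v xi <= b)%R]
      | f in moment_ambiguity_set mu Sigma gamma1 gamma2])%E <->
  (v^T *m mu) 0 0 + Num.sqrt (gamma2 / alpha) * Num.sqrt (quadform Sigma v)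
    <= b.
Proof.
move=> pS v0 a0 g20 g12 ag.
have q0 : 0 < quadform Sigma v by case: pS => _; apply.
set th := (v^T *m mu) 0 0; set q := quadform Sigma v in q0 *.
rewrite -sqrtrM ?divr_ge0 ?(ltW a0) ?(ltW g20) //.
set t2 := gamma2 / alpha * q.
have t20 : 0 < t2 by rewrite mulr_gt0 ?divr_gt0.
split=> [hinf|hb].
- rewrite leNgt; apply/negP => hb.
  have [p [ap pg pb]] : exists p, [/\ alpha < p, p <= gamma1 / gamma2 &
      b < th + Num.sqrt (gamma2 / p * q)].
    have [bth|thb] := ltP b th.
      exists (gamma1 / gamma2); split => //.
      by apply: (lt_le_trans bth); rewrite lerDl sqrtr_ge0.
    have : (b - th) ^+ 2 < t2.
      rewrite -[t2]sqr_sqrtr ?ltW // ltr_pXn2r ?nnegrE ?sqrtr_ge0 //; lra.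
    set e := (b - th) ^+ 2; rewrite /t2 mulrAC ltr_pdivlMr // => dlt.
    have e0 : 0 <= e by exact: sqr_ge0.
    (* The last requirement on [p] is [p * e < gamma2 * q], which leaves a
       slack of about [d] above [alpha]; the denominator is [e + 1] because [e]
       may vanish. *)
    pose d := (gamma2 * q - e * alpha) / (e + 1).
    have d0 : 0 < d by rewrite divr_gt0 //; lra.
    have de : d * e < gamma2 * q - e * alpha.
      by rewrite mulrAC ltr_pdivrMr; nra.
    have ap : alpha < Num.min (gamma1 / gamma2) (alpha + d).
      by rewrite lt_min ag ltrDl.
    exists (Num.min (gamma1 / gamma2) (alpha + d)); split => //.
      by rewrite ge_min lexx.
    have : Num.min (gamma1 / gamma2) (alpha + d) <= alpha + d.
      by rewrite ge_min lexx orbT.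
    move: (Num.min _ _) ap => p ap pd; have p0 : 0 < p by exact: lt_trans ap.
    rewrite -ltrBlDl -[ltLHS]ger0_norm ?subr_ge0 // -sqrtr_sqr ltr_sqrt.
      by rewrite mulrAC ltr_pdivlMr // -/e; nra.
    by rewrite mulr_gt0 ?divr_gt0.
  have p0 : 0 < p by exact: lt_trans ap.
  have p1 : p <= 1 by rewrite (le_trans pg) // ler_pdivrMr // mul1r.
  pose s := Num.sqrt (gamma2 / p / q).
  have s2 : s ^+ 2 = gamma2 / p / q by rewrite sqr_sqrtr // !divr_ge0 ?ltW.
  have [||||f fS fle] :=
    two_point_ambiguity mu v Sigma gamma1 gamma2 p s b pS.
  + by rewrite (ltW p0).
  + by rewrite s2 -/q; field; rewrite !gt_eqF.
  + by rewrite -ler_pdivlMr.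
  + suff -> : s * quadform Sigma v = Num.sqrt (gamma2 / p * q) by [].
    rewrite -/q -[q in LHS]ger0_norm ?ltW // -sqrtr_sqr -sqrtrM; last first.
      by rewrite !divr_ge0 ?ltW.
    by congr Num.sqrt; field; rewrite !gt_eqF.
  have : ((1 - alpha)%:E <= (1 - p)%:E)%E.
    apply: (le_trans hinf); apply: ge_ereal_inf.
    by exists (f [set xi | (dotp v xi <= b)%R]); first by exists f.
  by rewrite lee_fin; lra.
- apply: le_ereal_inf_tmp => _ [f [_ _ intf _ [_ hM]] <-].
  have mA := measurable_dotp_le v b.
  have tail : (f (~` [set xi | (dotp v xi <= b)%R]) <= alpha%:E)%E.
    have t0 : 0 < Num.sqrt t2 by rewrite sqrtr_gt0.
    apply: (@le_trans _ _ (f [set xi | th + Num.sqrt t2 <= dotp v xi]%R)).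
      apply: le_measure; rewrite ?inE.
      - exact: measurableC.
      - exact: measurable_le_dotp.
      - by move=> xi /= /negP; rewrite -ltNge => /ltW; apply: le_trans.
    apply: (le_trans (dotp_tail_le _ _ _ _ t0 intf)).
    rewrite lee_fin ler_pdivrMr ?exprn_gt0 // sqr_sqrtr ?(ltW t20) //.
    have -> : alpha * t2 = gamma2 * q by rewrite /t2; field; rewrite gt_eqF.
    by have := hM v; rewrite quadformB quadformZ subr_ge0.
  move: tail; rewrite probability_setC //.
  by rewrite -[f [set xi | _]]fineK ?fin_num_measure // -EFinB !lee_fin; lra.
Qed.

Theorem theorem3 (R : realType) (NHVAC NPV : nat)
    (NHVAC_ge1 : (1 <= NHVAC)%N) (NPV_ge1 : (1 <= NPV)%N)
    (P : 'I_NHVAC -> R) (P_gt0 : forall l, 0 < P l)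
    (mu : 'cV[R]_NPV) (Sigma : 'M[R]_NPV) (Sigma_pd : posdefmx Sigma)
    (gamma1 gamma2 : R) (gamma1_ge0 : 0 <= gamma1)
    (gamma2_ge : Num.max gamma1 1 <= gamma2)
    (alpha : R) (alpha_gt0 : 0 < alpha) (alpha_lt1 : alpha < 1)
    (gamma_alpha : alpha < gamma1 / gamma2)
    (u : 'I_NHVAC -> bool) :
  let ones : 'cV[R]_NPV := const_mx 1 in
  let theta : R := (ones^T *m mu) 0 0 in
  let sigma : R := Num.sqrt (quadform Sigma ones) in
  let load : R := \sum_(l < NHVAC) P l * (u l)%:R in
  let drcc : Prop :=
    ((1 - alpha)%R%:E <=
      ereal_inf [set f [set xi : NPV.-tuple R |
                        (0 <= load - \sum_(i < NPV) tnth xi i)%R]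
                | f in moment_ambiguity_set mu Sigma gamma1 gamma2])%E in
  (drcc <-> theta + Num.sqrt (gamma2 / alpha) * sigma <= load) /\
  (drcc <-> exists phi q w : R,
    [/\ theta + phi * sigma * Num.sqrt gamma2 <= load,
        l2norm (col2 (alpha - phi) (2 * q)) <= alpha + phi,
        w ^+ 2 <= phi
      & l2norm (col2 (q - w) 2) <= q + w]).
Proof.
move=> ones theta sigma load drcc.
have [g12 g21] : gamma1 <= gamma2 /\ 1 <= gamma2.
  by move: gamma2_ge; rewrite ge_max => /andP.
have g20 : 0 < gamma2 by exact: lt_le_trans g21.
have ones0 : ones != 0.
  apply/negP => /eqP/colP/(_ (Ordinal NPV_ge1)); rewrite !mxE.
  by apply/eqP; rewrite oner_eq0.
have sigma0 : 0 <= sigma by exact: sqrtr_ge0.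
have drccP : drcc <-> theta + Num.sqrt (gamma2 / alpha) * sigma <= load.
  rewrite -(drcc_halfspaceP _ _ _ gamma1) //.
  rewrite /drcc; under eq_set => xi.
    have -> : (0 <= load - \sum_(i < NPV) tnth xi i) = (dotp ones xi <= load).
      rewrite subr_ge0 /dotp; congr (_ <= _).
      by apply: eq_bigr => i _; rewrite mxE mul1r.
    over.
  by [].
split=> //; apply: (iff_trans drccP).
have -> : Num.sqrt (gamma2 / alpha) * sigma =
    (Num.sqrt alpha)^-1 * sigma * Num.sqrt gamma2.
  by rewrite sqrtrM ?(ltW g20) // sqrtrV ?(ltW alpha_gt0) //; ring.
split=> [hload|[phi [q [w [hload h1 h2 h3]]]]].
- have [//|q [w [h1 h2 h3]]] := (cone_chainP alpha (Num.sqrt alpha)^-1 alpha_gt0).2.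
  by exists (Num.sqrt alpha)^-1, q, w; split.
- have /cone_chainP hphi : exists q w : R,
      [/\ l2norm (col2 (alpha - phi) (2 * q)) <= alpha + phi,
         w ^+ 2 <= phi & l2norm (col2 (q - w) 2) <= q + w] by exists q, w.
  apply: le_trans hload; rewrite lerD2l ler_wpM2r ?sqrtr_ge0 //.
  by rewrite ler_wpM2r // hphi.
Qed.
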